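(* Let $u\in[0,\pi/4]$ and let $m$ be a fixed positive integer that is a sum of two integer squares. For $L>0$ let $\mathcal{Z}$ be the number of zeroes of the rescaled arithmetic random wave $\Psi_m$ on the segment $\{t(\cos u,\sin u):0\le t\le L\}$. Suppose that $\nu_m$ does not have a point mass at $(\cos u,\sin u)$. Then $\log\mathbb{P}(\mathcal{Z}=0)=O(-L^2)$ as $L\to\infty$, in the sense of an upper bound: there exists a constant $C>0$ (not depending on $L$) such that for all sufficiently large $L$ $$\log\mathbb{P}(\mathcal{Z}=0)\le -C L^2 .$$
   Context: For $m$ a sum of two integer squares put $\Lambda_m=\{\lambda\in\mathbb{Z}^2:|\lambda|^2=m\}$ and $r_2(m)=|\Lambda_m|$. The spectral measure is $\nu_m=\frac1{r_2(m)}\sum_{\lambda\in\Lambda_m}\delta_{\lambda/\sqrt m}$ on the unit circle. The rescaled arithmetic random wave is $\Psi_m(x)=\frac{1}{\sqrt{r_2(m)}}\sum_{\lambda\in\Lambda_m}a_\lambda e^{2\pi i\langle\lambda/\sqrt m,x\rangle}$ for $x\in\mathbb{R}^2$, where the $a_\lambda$ are complex standard Gaussians ($\mathbb{E}[a_\lambda]=0$, $\mathbb{E}[|a_\lambda|^2]=1$; real and imaginary parts independent $\mathcal N(0,1/2)$), independent except for $a_{-\lambda}=\overline{a_\lambda}$. Convention: $\log 0=-\infty$. *)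

(* Defs.v *)
From HB Require Import structures.
From mathcomp Require Import all_boot all_order all_algebra finmap.
From mathcomp Require Import all_classical all_reals all_analysis.
From mathcomp Require Import complex.

Set Implicit Arguments.
Unset Strict Implicit.
Unset Printing Implicit Defensive.

Import Order.TTheory GRing.Theory Num.Theory.
Import numFieldNormedType.Exports.

Local Open Scope classical_set_scope.
Local Open Scope ring_scope.
Local Open Scope complex_scope.

(* Independence of the random variables X i, i in S: the product rule over
   every finite subfamily. *)
Definition mutually_independent (d d' : measure_display)
    (T : measurableType d) (U : measurableType d') (R : realType)
    (P : probability T R) (I : choiceType) (S : set I) (X : I -> T -> U) :=
  forall (J : {fset I}) (B : I -> set U),
    [set` J] `<=` S -> (forall i, i \in J -> measurable (B i)) ->
    P (\bigcap_(i in [set` J]) (X i @^-1` B i)) =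
    (\prod_(i <- J) P (X i @^-1` B i))%E.

Definition sum_of_two_squares (m : nat) :=
  exists x y : int, x ^+ 2 + y ^+ 2 = m%:Z.

Definition Lambda (m : nat) : set (int * int) :=
  [set l | l.1 ^+ 2 + l.2 ^+ 2 = m%:Z].

(* This makes [fset_set (Lambda m)] and the sums over [Lambda m] below, which
   have default values on infinite sets, meaningful. *)
Lemma finite_Lambda m : finite_set (Lambda m).
Proof.
pose A := [set x : int | (`|x| <= m)%N].
have finA : finite_set A.
  apply: (@sub_finite_set _ _ ([set Posz n | n in `I_m.+1] `|`
                               [set - Posz n | n in `I_m.+1])).
    move=> x /= xm; case: (ger0P x) => x0.
      by left; exists `|x|%N => //; rewrite gez0_abs.
    by right; exists `|x|%N => //; rewrite lez0_abs ?opprK// ltW.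
  by rewrite finite_setU; split; apply: finite_image; exact: finite_II.
have bnd (x y : int) : x ^+ 2 + y ^+ 2 = m%:Z -> (`|x| <= m)%N.
  move=> xy; have : (`|x| ^ 2 <= m)%N.
    by rewrite -lez_nat -abszX gez0_abs ?sqr_ge0// -xy lerDl sqr_ge0.
  by apply: leq_trans; case: `|x|%N => // n; rewrite expnS leq_pmulr ?expn_gt0.
apply: sub_finite_set (finite_setX finA finA) => -[x y] /= xy.
by split; [exact: (bnd x y)|apply: (bnd y x); rewrite addrC].
Qed.

Definition r2 (m : nat) : nat := #|` fset_set (Lambda m)|.

Section arithmetic_random_wave.
Variable R : realType.

Definition frequency (m : nat) (l : int * int) : R * R :=
  (l.1%:~R / Num.sqrt m%:R, l.2%:~R / Num.sqrt m%:R).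

Definition spectral_measure (m : nat) (A : set (R * R)) : \bar R :=
  (((r2 m)%:R^-1)%:E * \sum_(l \in Lambda m) (\d_(frequency m l) A : \bar R))%E.

Definition dotp (x y : R * R) : R := x.1 * y.1 + x.2 * y.2.

(* exp(i t) *)
Definition cis (t : R) : R[i] := cos t +i* sin t.

Definition coords (z : R[i]) : R * R := (complex.Re z, complex.Im z).

Section coefficients.
Context (d : measure_display) (T : measurableType d) (P : probability T R).

(* The second argument of [normal_prob] is the standard deviation. *)
Definition gaussian0_half (X : T -> R) :=
  measurable_fun setT X /\
  forall A : set R, measurable A ->
    pushforward P X A = normal_prob 0 (Num.sqrt 2^-1) A.

Definition complex_standard_gaussian (z : T -> R[i]) :=
  [/\ gaussian0_half (fun w => complex.Re (z w)),
      gaussian0_half (fun w => complex.Im (z w)) &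
      mutually_independent P setT (fun (b : bool) w =>
        if b then complex.Re (z w) else complex.Im (z w))].

(* "Independent except for a_{-l} = conj a_l" : the subfamilies that do not
   contain both l and - l are independent, as complex random variables. *)
Definition arw_coefficients (m : nat) (a : int * int -> T -> R[i]) :=
  [/\ forall l, Lambda m l -> complex_standard_gaussian (a l),
      forall l, Lambda m l -> forall w, a (- l) w = (a l w)^* &
      forall S : set (int * int), S `<=` Lambda m ->
        (forall l, S l -> ~ S (- l)) ->
        mutually_independent P S (fun l w => coords (a l w))].

End coefficients.

(* The wave is real-valued when a (- l) = conj (a l). *)
Definition wave (T : Type) (m : nat) (a : int * int -> T -> R[i])
    (w : T) (x : R * R) : R[i] :=
  ((Num.sqrt (r2 m)%:R)^-1)%:C *
  \sum_(l \in Lambda m) a l w * cis (2 * pi * dotp (frequency m l) x).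

Definition segment (u L : R) : set (R * R) :=
  [set (t * cos u, t * sin u) | t in `[0, L]].

(* Number of zeroes on the segment, +oo if there are infinitely many. *)
Definition nb_zeroes (T : Type) (m : nat) (a : int * int -> T -> R[i])
    (u L : R) (w : T) : \bar R :=
  counting [set x | segment u L x /\ wave m a w x = 0].

End arithmetic_random_wave.

(* Main.v *)
Require Import Defs.
From mathcomp Require Import all_boot all_order all_algebra.
From mathcomp Require Import all_classical all_reals all_analysis.
From mathcomp Require Import complex.
From mathcomp Require Import finmap ring lra.

Set Implicit Arguments.
Unset Strict Implicit.
Unset Printing Implicit Defensive.

Import Order.TTheory GRing.Theory Num.Theory.
Import numFieldNormedType.Exports.

Local Open Scope classical_set_scope.
Local Open Scope ring_scope.

(** Restricted to the line spanned by [p = (cos u, sin u)], the wave is a real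
trigonometric polynomial whose frequencies are the projections onto [p] of the
finitely many points of [Lambda m] divided by the square root of [m]. The
spectrum is invariant under the rotation by a right angle, so a frequency whose
projection vanishes is orthogonal to [p] and rotates to [p] itself; as the
spectral measure does not charge [p], there is no such frequency
([dotp_frequency_neq0]).

A real trigonometric polynomial without constant term vanishes somewhere on
every interval [[0, S]] whose length [S] is at least the sum of the half
periods of its terms ([trig_sum_zero]): adding to [f] its translate by a half
period cancels one term, and if the resulting function vanishes at [t], then
[f] takes opposite values at [t] and at the translate of [t], so that it
vanishes between them.

Hence there is a length [S], determined by [m] and [u] alone, such that every
realization of the wave has a zero on the segment as soon as [L] exceeds [S].
The event of having no zero is then empty, its probability is [0], the
logarithm is minus infinity, and every constant [C] will do. *)

(** * Zeroes of trigonometric polynomials without constant term *)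

Section trigonometric_sums.
Variables (R : realType) (I : eqType).
Implicit Types (s : seq I) (A B w : I -> R) (f : R -> R).

Definition trig_sum s A B w (t : R) : R :=
  \sum_(i <- s) (A i * cos (w i * t) + B i * sin (w i * t)).

Lemma continuous_trig_sum s A B w : continuous (trig_sum s A B w).
Proof.
have continuous_scale (c : R) : continuous (fun x : R => c * x).
  by move=> x; apply: continuousM; [exact: cvg_cst|exact: cvg_id].
apply: continuous_big; first exact: add_continuous.
move=> i _ t; apply: cvgD.
  apply: continuousM; first exact: cvg_cst.
  by apply: continuous_comp; [exact: continuous_scale|exact: continuous_cos].
apply: continuousM; first exact: cvg_cst.
by apply: continuous_comp; [exact: continuous_scale|exact: continuous_sin].
Qed.

Lemma zero_of_add_translate f (h S : R) : continuous f -> 0 <= h ->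
  (exists2 t, 0 <= t <= S & f t + f (t + h) = 0) ->
  exists2 t, 0 <= t <= S + h & f t = 0.
Proof.
move=> cf h0 [t /andP[t0 tS] ft].
have [||c] := @IVT R f t (t + h) 0 _ (continuous_subspaceT cf).
- by rewrite lerDl.
- have -> : f (t + h) = - f t by lra.
  rewrite ge_min le_max !oppr_ge0 !oppr_le0.
  by case: (ger0P (f t)) => [|/ltW ->]; rewrite ?orbT.
by rewrite in_itv/= => /andP[tc cth] fc; exists c => //; lra.
Qed.

Definition half_period (x : R) : R := pi / `|x|.

Lemma half_period_ge0 (x : R) : 0 <= half_period x.
Proof. by rewrite divr_ge0// pi_ge0. Qed.

Lemma mul_half_period (x : R) : x != 0 ->
  x * half_period x = pi \/ x * half_period x = - pi.
Proof.
rewrite /half_period => x0; case: (ger0P x) => _; [left|right].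
  by rewrite mulrC divfK.
by rewrite invrN !mulrN mulrC divfK.
Qed.

Lemma cos_half_period (x t : R) : x != 0 ->
  cos (x * (t + half_period x)) = - cos (x * t).
Proof.
move=> /mul_half_period; rewrite mulrDr => -[] ->; first exact: cosDpi.
by rewrite -[in RHS](subrK pi (x * t)) cosDpi opprK.
Qed.

Lemma sin_half_period (x t : R) : x != 0 ->
  sin (x * (t + half_period x)) = - sin (x * t).
Proof.
move=> /mul_half_period; rewrite mulrDr => -[] ->; first exact: sinDpi.
by rewrite -[in RHS](subrK pi (x * t)) sinDpi opprK.
Qed.

(** The bound on the location of the zero depends on the frequencies only: this
uniformity in the coefficients is what turns a statement on functions into one
that holds for all realizations of a random function. *)
Lemma trig_sum_zero s A B w : (forall i, i \in s -> w i != 0) ->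
  exists2 t, 0 <= t <= \sum_(i <- s) half_period (w i) &
    trig_sum s A B w t = 0.
Proof.
elim: s A B => [|i s IHs] A B ws.
  by exists 0; rewrite /trig_sum ?big_nil// lexx.
rewrite big_cons addrC.
have wi : w i != 0 by rewrite ws// mem_head.
set h := half_period (w i).
apply: zero_of_add_translate; [exact: continuous_trig_sum|
  exact: half_period_ge0|].
(* The addition formulas give the coefficients of [f t + f (t + h)], whose
   term of index [i] vanishes by the choice of [h]. *)
pose A' j := A j * (1 + cos (w j * h)) + B j * sin (w j * h).
pose B' j := B j * (1 + cos (w j * h)) - A j * sin (w j * h).
have [j js|t tS ft] := IHs A' B'; first by rewrite ws// in_cons js orbT.
exists t => //; rewrite -ft /trig_sum !big_cons.
rewrite cos_half_period// sin_half_period// addrACA.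
rewrite [X in X + _](_ : _ = 0) ?add0r; last by ring.
rewrite -big_split/=; apply: eq_bigr => j _.
by rewrite /A' /B' mulrDr cosD sinD; ring.
Qed.

End trigonometric_sums.

(** * The spectrum *)

Section spectrum.
Variable R : realType.

Lemma LambdaN m l : Lambda m l -> Lambda m (- l).
Proof. by rewrite /Lambda/= => <-; rewrite !sqrrN. Qed.

Lemma frequency_norm m l : (0 < m)%N -> Lambda m l ->
  (frequency R m l).1 ^+ 2 + (frequency R m l).2 ^+ 2 = 1.
Proof.
move=> m0 /= lm; rewrite !expr_div_n sqr_sqrtr// -mulrDl.
have -> : (l.1%:~R ^+ 2 + l.2%:~R ^+ 2 : R) = m%:R.
  by rewrite -!rmorphXn -rmorphD lm.
by rewrite divff// pnatr_eq0 -lt0n.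
Qed.

Lemma spectral_measure0_neq m (p : R * R) l :
  spectral_measure m [set p] = 0%E -> Lambda m l -> frequency R m l != p.
Proof.
move=> mp lm; apply/eqP => lp; move/eqP: mp.
have [finL r2_gt0] : finite_set (Lambda m) /\ (0 < r2 m)%N.
  split; first exact: finite_Lambda.
  rewrite /r2 cardfs_gt0; apply/fset0Pn; exists l.
  by rewrite in_fset_set ?mem_set//; exact: finite_Lambda.
rewrite /spectral_measure mule_eq0 eqe invr_eq0 pnatr_eq0 gtn_eqF//=.
move=> /eqP /(pfsume_eq0 finL) => /(_ (fun _ _ => measure_ge0 _ _) l lm).
by rewrite lp diracE mem_set// => /eqP; rewrite eqe oner_eq0.
Qed.

(** A unit vector orthogonal to [p] becomes [p] or [- p] after a rotation by a
right angle, and [p] itself after one of the two possible rotations. Both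
rotations map [Lambda m] to itself, and [p] is not a frequency. *)
Lemma dotp_frequency_neq0 m (p : R * R) l : (0 < m)%N ->
  p.1 ^+ 2 + p.2 ^+ 2 = 1 -> spectral_measure m [set p] = 0%E ->
  Lambda m l -> dotp (frequency R m l) p != 0.
Proof.
case: p => c s /= m0 p1 mp lm; apply/eqP => /= lp.
have l1 : Lambda m (l.2, - l.1) by rewrite /Lambda/= sqrrN addrC.
have l2 : Lambda m (- l.2, l.1) by rewrite /Lambda/= sqrrN addrC.
have := spectral_measure0_neq mp l1; have := spectral_measure0_neq mp l2.
move: lp (frequency_norm m0 lm); rewrite /dotp /frequency/= !rmorphN !mulNr.
set x := _ / _; set y := _ / _ => xy0 xy1.
(* [q] is the sine of the angle from [(x, y)] to [p]. *)
pose q := x * s - y * c.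
have q1 : (q - 1) * (q + 1) = 0.
  suff : q ^+ 2 + (x * c + y * s) ^+ 2 = 1 by rewrite xy0; move=> ?; nra.
  transitivity ((x ^+ 2 + y ^+ 2) * (c ^+ 2 + s ^+ 2)).
    by rewrite /q; ring.
  by rewrite xy1 p1 mulr1.
have cE : c = - (y * q).
  transitivity (c * (x ^+ 2 + y ^+ 2)); first by rewrite xy1 mulr1.
  transitivity (x * (x * c + y * s) - y * q); first by rewrite /q; ring.
  by rewrite xy0 mulr0 add0r.
have sE : s = x * q.
  transitivity (s * (x ^+ 2 + y ^+ 2)); first by rewrite xy1 mulr1.
  transitivity (y * (x * c + y * s) + x * q); first by rewrite /q; ring.
  by rewrite xy0 mulr0 add0r.
move/eqP: q1; rewrite mulf_eq0 subr_eq0 addr_eq0 => /orP[] /eqP q1.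
  by rewrite cE sE q1 !mulr1 eqxx.
by rewrite cE sE q1 !mulrN1 opprK eqxx.
Qed.

End spectrum.

(** * Realizations of the wave *)

Section realizations.
Local Open Scope complex_scope.
Variable R : realType.
Implicit Types (a : int * int -> R[i]).

(** The sum over the spectrum equals its own conjugate, by exchanging the
terms of [l] and [- l]. *)
Lemma Im_wave_sum m a (p : R * R) :
  (forall l, Lambda m l -> a (- l) = (a l)^*) ->
  complex.Im (\sum_(l \in Lambda m)
      a l * cis (2 * pi * dotp (frequency R m l) p)) = 0.
Proof.
move=> aN; set z := \sum_(l \in _) _.
suff : z^* = z by case: z => x y [] ?; rewrite /=; lra.
rewrite /z [in RHS](reindex_fsbig (fun l : int * int => - l) (Lambda m));
  last first.
  split=> [l|l k _ _|l lm]; [exact: LambdaN|exact: oppr_inj|].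
  by exists (- l); [exact: LambdaN|rewrite opprK].
rewrite !(fsbig_finite _ _ (finite_Lambda m)) rmorph_sum/=.
apply: eq_big_seq => l.
rewrite in_fset_set => [/set_mem lm|]; last exact: finite_Lambda.
rewrite rmorphM aN//; congr (_ * _).
rewrite (_ : dotp (frequency R m (- l)) p = - dotp (frequency R m l) p).
  by rewrite mulrN /cis cosN sinN.
by rewrite /dotp /frequency/= !rmorphN; ring.
Qed.

Lemma Re_wave_sum m a (p : R * R) (t : R) :
  complex.Re (\sum_(l \in Lambda m)
      a l * cis (2 * pi * dotp (frequency R m l) (t * p.1, t * p.2))) =
  trig_sum (fset_set (Lambda m)) (fun l => complex.Re (a l))
    (fun l => - complex.Im (a l))
    (fun l => 2 * pi * dotp (frequency R m l) p) t.
Proof.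
rewrite (fsbig_finite _ _ (finite_Lambda m)) raddf_sum/=.
apply: eq_bigr => l _.
have -> : dotp (frequency R m l) (t * p.1, t * p.2) =
    dotp (frequency R m l) p * t by rewrite /dotp/=; ring.
by rewrite mulrA; case: (a l) => x y /=; rewrite mulNr.
Qed.

Lemma counting_neq0 (T : choiceType) (A : set T) :
  A !=set0 -> (counting A : \bar R) != 0%E.
Proof.
move=> [x Ax]; rewrite /counting; case: asboolP => // finA.
rewrite eqe pnatr_eq0 -lt0n cardfs_gt0; apply/fset0Pn; exists x.
by rewrite in_fset_set// mem_set.
Qed.

End realizations.

Theorem proposition1p5 (R : realType) (d : measure_display)
    (T : measurableType d) (P : probability T R) (u : R) (m : nat)
    (a : int * int -> T -> R[i]) :
  0 <= u <= pi / 4 ->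
  (0 < m)%N ->
  sum_of_two_squares m ->
  arw_coefficients P m a ->
  spectral_measure m [set (cos u, sin u)] = 0%E ->
  exists C : R, 0 < C /\
    \forall L \near +oo,
      (lne (P [set w | nb_zeroes m a u L w = 0%E]) <= (- (C * L ^+ 2))%:E)%E.
Proof.
move=> _ m0 _ [_ aN _] mu; exists 1; split => //.
pose p := (cos u, sin u).
pose S := \sum_(l <- fset_set (Lambda m))
  half_period (2 * pi * dotp (frequency R m l) p).
near=> L; have SL : S <= L by near: L; exact: (nbhs_pinfty_ge (num_real S)).
suff -> : [set w | nb_zeroes m a u L w = 0%E] = set0.
  by rewrite measure0 le0_lneNy ?lexx// leNye.
rewrite -subset0 => w /= /eqP; apply/negP/counting_neq0.
have [|t /andP[t0 tS] ft] := @trig_sum_zero R _ (fset_set (Lambda m))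
    (fun l => complex.Re (a l w)) (fun l => - complex.Im (a l w))
    (fun l => 2 * pi * dotp (frequency R m l) p).
  move=> l; rewrite in_fset_set => [/set_mem lm|]; last exact: finite_Lambda.
  rewrite !mulf_neq0 ?pnatr_eq0//; first by rewrite gt_eqF// pi_gt0.
  by apply: dotp_frequency_neq0 => //; exact: cos2Dsin2.
exists (t * cos u, t * sin u); split.
  by exists t => //=; rewrite in_itv/= t0 (le_trans tS).
rewrite /wave [X in _ * X](_ : _ = 0) ?mulr0//.
apply/eqP; rewrite eq_complex (Re_wave_sum m (a ^~ w) p t) ft.
by rewrite (@Im_wave_sum R m (a ^~ w)) ?eqxx// => l lm; exact: aN.
Unshelve. all: by end_near. Qed.
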